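(* Let all channel realizations in the finite set $\mathcal H$ be equally likely. The average delay, when time-sharing between the first-to-complete scheme (using alignment sets of both sizes $2$ and $4$) and channel-complement alignment, is lower than the average delay when using only complements (that is, only channel-complement alignment).
   Context: $\mathcal H$ is a finite set of complex $K\times K$ matrices (quantized channel realizations $\mathbf H=[h_{kl}]$). At each time step a channel realization $\mathbf H(t)\in\mathcal H$ occurs, uniformly distributed on $\mathcal H$ and independent over time. The complement $\mathbf H^c$ of $\mathbf H$ has entries $h_{kk}$ on the diagonal and $-h_{kl}$ for $k\ne l$. An alignment set of size $m$ ($m$ a positive even integer) is a collection of $m$ matrices $\mathbf H^{(0)},\ldots,\mathbf H^{(m-1)}$ such that $h^{(0)}_{kk}=\cdots=h^{(m-1)}_{kk}$ for all $k$, and for all $k\ne l$: $|h^{(0)}_{kl}|=\cdots=|h^{(m-1)}_{kl}|$, exactly $\frac m2-1$ of the indices $i\in\{1,\ldots,m-1\}$ satisfy $h^{(i)}_{kl}=h^{(0)}_{kl}$, and exactly $\frac m2$ satisfy $h^{(i)}_{kl}=-h^{(0)}_{kl}$. Thus $\{\mathbf H,\mathbf H^c\}$ is an alignment set of size $2$. $\mathcal A_{\mathbf H}$ denotes an alignment set of size $4$ having $\mathbf H$ as a member; its four members are distinct elements of $\mathcal H$, and it does not contain $\mathbf H^c\in\mathcal H$. Channel-complement alignment: a symbol first sent at time $t_0$, when the realization is $\mathbf H$, is recovered at the first time $t>t_0$ at which $\mathbf H^c$ occurs. First-to-complete scheme: a symbol first sent at time $t_0$, when the realization is $\mathbf H$,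 is recovered at the first time $t>t_0$ by which either $\mathbf H^c$ has occurred or all three other members of $\mathcal A_{\mathbf H}$ have occurred (occurrences being counted at times after $t_0$). Time-sharing scheme, with parameter $0\le\alpha\le1$: for the realization $\mathbf H$ at $t_0$, independently of the channel, with probability $1-\alpha$ use channel-complement alignment and with probability $\alpha$ use the first-to-complete scheme. The average delay of a scheme is the expected number of time steps between the first time a symbol is sent and the time it is recovered at the receiver (recovery at time $t_1$ gives delay $t_1-t_0$).
   Formalization: ''Lower'' is taken as strictly lower only when the time-sharing parameter α is positive; at α = 0 time-sharing is channel-complement alignment itself, the average delays coincide, and only ''not larger'' is claimed. *)

(* Defs.v *)
From HB Require Import structures.
From mathcomp Require Import all_boot all_order all_algebra finmap.
From mathcomp Require Import complex.
From mathcomp Require Import all_classical all_reals all_analysis.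

Set Implicit Arguments.
Unset Strict Implicit.
Unset Printing Implicit Defensive.

Import Order.TTheory GRing.Theory Num.Theory.

Local Open Scope classical_set_scope.
Local Open Scope ring_scope.
Local Open Scope complex_scope.

Section Matrices.
Context {R : realType} {K : nat}.
Implicit Types (M : 'M[R[i]]_K) (B : seq 'M[R[i]]_K).

Definition channel_complement M : 'M[R[i]]_K :=
  \matrix_(k, l) if k == l then M k l else - M k l.

(* The collection is listed as B = [:: H^(0); ...; H^(m-1)], so that
   behead B carries the indices 1, ..., m - 1. *)
Definition alignment_set (m : nat) B : Prop :=
  let M0 := head 0 B in
  [/\ (0 < m)%N, ~~ odd m, size B = m,
      (forall k M, M \in B -> M k k = M0 k k) &
      (forall k l, k != l ->
        [/\ (forall M, M \in B -> `|M k l| = `|M0 k l|),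
            count (fun M : 'M[R[i]]_K => M k l == M0 k l) (behead B) =
              (m./2 - 1)%N &
            count (fun M : 'M[R[i]]_K => M k l == - M0 k l) (behead B) =
              m./2])].

(* B can serve as the size-4 alignment set A_M of the first-to-complete scheme
   for the finite set of realizations Hs. *)
Definition alignment4_for (Hs : {fset 'M[R[i]]_K}) M B : Prop :=
  [/\ alignment_set 4 B, M \in B, uniq B, {subset B <= Hs} &
      channel_complement M \in Hs /\ channel_complement M \notin B].

(* Sample paths are functions h : nat -> 'M_K; occurrences are counted at
   times s with t0 < s <= t. *)
Definition occurred (h : nat -> 'M[R[i]]_K) (t0 t : nat) M : Prop :=
  exists2 s : nat, (t0 < s <= t)%N & h s = M.

(* Number of steps from t0 to the first t > t0 with Q t (+oo if none). *)
Definition delay (t0 : nat) (Q : nat -> Prop) : \bar R :=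
  ereal_inf [set ((t - t0)%N%:R)%:E | t in [set t : nat | (t0 < t)%N /\ Q t]].

Definition complement_delay (h : nat -> 'M[R[i]]_K) (t0 : nat) : \bar R :=
  delay t0 (fun t => h t = channel_complement (h t0)).

Definition first_to_complete_delay
    (A : 'M[R[i]]_K -> seq 'M[R[i]]_K) (h : nat -> 'M[R[i]]_K) (t0 : nat) :
    \bar R :=
  delay t0 (fun t =>
    occurred h t0 t (channel_complement (h t0)) \/
    (forall M, M \in A (h t0) -> M != h t0 -> occurred h t0 t M)).

(* The coin c selects first-to-complete when true. *)
Definition time_sharing_delay
    (A : 'M[R[i]]_K -> seq 'M[R[i]]_K) (c : bool) (h : nat -> 'M[R[i]]_K)
    (t0 : nat) : \bar R :=
  if c then first_to_complete_delay A h t0 else complement_delay h t0.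

End Matrices.

Section Probability.
Context {d : measure_display} {T : measurableType d} {R : realType}.
Variable P : probability T R.

(* Discrete-valued random variables: the value type S carries the full
   powerset as sigma-algebra. *)
Definition discrete_rv {S : Type} (X : T -> S) : Prop :=
  forall E : set S, measurable (X @^-1` E).

Definition mutually_independent {S : Type} (X : nat -> T -> S) : Prop :=
  forall (J : seq nat) (E : nat -> set S), uniq J ->
    P (\bigcap_(t in [set` J]) (X t @^-1` E t)) =
    (\prod_(t <- J) P (X t @^-1` E t))%E.

Definition process_sigma {S : Type} (X : nat -> T -> S) : set (set T) :=
  <<s \bigcup_t preimage_set_system [set: T] (X t) [set: set S] >>.

Definition independent_of_process {S S' : Type}
    (Y : T -> S') (X : nat -> T -> S) : Prop :=
  forall (E : set S') (F : set T), process_sigma X F ->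
    P ((Y @^-1` E) `&` F) = (P (Y @^-1` E) * P F)%E.

Definition iid_uniform {S : choiceType} (Hs : {fset S}) (X : nat -> T -> S) :
    Prop :=
  [/\ (forall t, discrete_rv (X t)),
      (forall t w, X t w \in Hs),
      (forall t M, M \in Hs -> P (X t @^-1` [set M]) = (#|` Hs|%:R^-1)%:E) &
      mutually_independent X].

Definition independent_coin {S : Type} (alpha : R) (X : nat -> T -> S)
    (C : T -> bool) : Prop :=
  [/\ discrete_rv C, P (C @^-1` [set true]) = alpha%:E &
      independent_of_process C X].

Definition average_delay (D : T -> \bar R) : \bar R := (\int[P]_w D w)%E.

End Probability.

(* Main.v *)
(* The time-shared delay is pointwise at most the complement delay, because the
   occurrence of H^c also stops the first-to-complete scheme.  With n equally
   likely realizations the complement has not occurred after k steps with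
   probability (1 - 1/n)^k, and summing over k shows that the complement delay
   has the finite mean n; finiteness is what allows a strict comparison.  When
   the coin selects first-to-complete, H(t0) = M and the next three
   realizations list A_M minus M, the delay is at most 3 for first-to-complete
   but at least 4 for complements.  This event has probability
   alpha * n^-4 > 0. *)
Require Import Defs.
From HB Require Import structures.
From mathcomp Require Import all_boot all_order all_algebra finmap.
From mathcomp Require Import complex.
From mathcomp Require Import all_classical all_reals all_analysis.
From mathcomp Require Import measurable_realfun.

Set Implicit Arguments.
Unset Strict Implicit.
Unset Printing Implicit Defensive.

Import Order.TTheory GRing.Theory Num.Theory.
Local Open Scope classical_set_scope.
Local Open Scope ring_scope.
Local Open Scope complex_scope.

(* Only the larger side is ever shown measurable: measurability of the
   time-shared delay is avoided because the integral of a nonnegative function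
   is a supremum over the simple functions below it. *)
Lemma ge0_le_integralT_nomeas (d : measure_display) (T : measurableType d)
    (R : realType) (mu : {measure set T -> \bar R}) (f g : T -> \bar R) :
  (forall x, 0 <= f x)%E -> (forall x, f x <= g x)%E ->
  (\int[mu]_x f x <= \int[mu]_x g x)%E.
Proof.
move=> f0 fg; have g0 x : (0 <= g x)%E := le_trans (f0 x) (fg x).
rewrite !ge0_integralTE//=; apply: ereal_sup_le => _ [h /= hf <-].
by exists h => // x; exact: le_trans (hf x) (fg x).
Qed.

(** * Delays: bounds, monotonicity and a tail-sum formula *)

Lemma delay_ge0 (R : realType) (t0 : nat) (Q : nat -> Prop) :
  (0 <= delay (R:=R) t0 Q)%E.
Proof. by apply: le_ereal_inf_tmp => _ [t _ <-]; rewrite lee_fin. Qed.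

Lemma delay_le (R : realType) (t0 : nat) (Q : nat -> Prop) (t : nat) :
  (t0 < t)%N -> Q t -> (delay (R:=R) t0 Q <= ((t - t0)%N%:R)%:E)%E.
Proof. by move=> t0t Qt; apply: ereal_inf_lbound; exists t. Qed.

Lemma delay_ge (R : realType) (t0 : nat) (Q : nat -> Prop) (m : nat) :
  (forall t, (t0 < t)%N -> Q t -> (m <= t - t0)%N) ->
  ((m%:R)%:E <= delay (R:=R) t0 Q)%E.
Proof.
move=> mQ; apply: le_ereal_inf_tmp => _ [t [t0t Qt] <-].
by rewrite lee_fin ler_nat mQ.
Qed.

Lemma delay_anti (R : realType) (t0 : nat) (Q Q' : nat -> Prop) :
  (forall t, (t0 < t)%N -> Q t -> Q' t) ->
  (delay (R:=R) t0 Q' <= delay (R:=R) t0 Q)%E.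
Proof.
move=> QQ'; apply: le_ereal_inf_tmp => _ [t [t0t Qt] <-].
exact/delay_le/QQ'.
Qed.

(** Pathwise tail-sum formula: the [k]-th term is 1 exactly when the first stopping step exceeds
    [k], so the ones are as many as the steps waited. It turns an infimum into a series that can be
    measured and integrated termwise. *)
Lemma delay_series (R : realType) (t0 : nat) (Q : nat -> Prop) :
  delay (R:=R) t0 Q =
  (\sum_(0 <= k <oo)
     (`[< forall j, (0 < j <= k)%N -> ~ Q (t0 + j)%N >]%:R)%:E)%E.
Proof.
pose b k := `[< forall j, (0 < j <= k)%N -> ~ Q (t0 + j)%N >].
rewrite -[RHS]/(\sum_(0 <= k <oo) ((b k)%:R)%:E)%E.
have [[t [t0t Qt]]|noQ] := pselect (exists t, (t0 < t)%N /\ Q t).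
  have ex : exists j, (0 < j)%N && `[< Q (t0 + j)%N >].
    exists (t - t0)%N; rewrite subn_gt0 t0t /= subnKC ?(ltnW t0t)//.
    exact/asboolP.
  have [m /andP[m0 /asboolP Qm] mmin] := ex_minnP ex.
  have bE k : b k = (k < m)%N.
    apply/asboolP/idP => [nQ|km j /andP[j0 jk] Qj].
      by rewrite ltnNge; apply/negP => mk; apply: (nQ m); rewrite ?m0.
    have : (m <= j)%N by apply: mmin; rewrite j0; apply/asboolP.
    by rewrite leqNgt (leq_ltn_trans jk km).
  transitivity ((m%:R : R)%:E).
    apply/eqP; rewrite eq_le; apply/andP; split.
      have := @delay_le R t0 Q (t0 + m)%N.
      by rewrite addKn -[X in (X < _)%N]addn0 ltn_add2l => /(_ m0 Qm).
    apply: delay_ge => t' t0t' Qt'; apply: mmin; rewrite subn_gt0 t0t' /=.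
    by apply/asboolP; rewrite subnKC // ltnW.
  apply/esym/lim_near_cst => //; exists m => // N /= mN.
  rewrite sumEFin; congr EFin.
  rewrite (@big_cat_nat _ _ _ m)//=.
  rewrite [X in X + _](@eq_big_nat _ _ _ _ _ _ (fun=> 1)) => [|k /andP[_ km]];
    last by rewrite bE km.
  rewrite [X in _ + X](@eq_big_nat _ _ _ _ _ _ (fun=> 0)) => [|k /andP[mk _]];
    last by rewrite bE ltnNge mk.
  by rewrite !sumr_const_nat mul0rn addr0 subn0.
have bE k : b k = true.
  apply/asboolP => j /andP[j0 _] Qj; apply: noQ; exists (t0 + j)%N; split => //.
  by rewrite -[X in (X < _)%N]addn0 ltn_add2l.
(* If [Q] never holds, the infimum is over the empty set, and the partial sums of ones exceed every
   real [r]. *)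
transitivity (+oo%E : \bar R).
  by apply/ereal_inf_pinfty => x [t Qt _]; case: noQ; exists t.
apply/esym/eqyP => r r0.
have /= le := @nneseries_lim_ge R (fun k => ((b k)%:R)%:E) xpredT 0
  (Num.truncn r).+1.
apply: le_trans (le _) => //.
rewrite sumEFin lee_fin (eq_bigr (fun=> 1)) => [|k _]; last by rewrite bE.
rewrite big_const_nat subn0 iter_addr_0; exact/ltW/truncnS_gt.
Qed.

(** * Cylinder events and the probability of a finite word *)

(* X reads the word L from time t0 on; x0 is only the default value of nth. *)
Definition word_event (T S : Type) (X : nat -> T -> S) (t0 : nat) (x0 : S)
    (L : seq S) : set T :=
  \bigcap_(t in [set` iota t0 (size L)]) (X t @^-1` [set nth x0 L (t - t0)]).

(** Independence of the coin is stated for events of [process_sigma], so cylinder events have to be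
    placed there. *)
Lemma process_sigma_bigcap (d : measure_display) (T : measurableType d)
    (S : Type) (X : nat -> T -> S) (J : seq nat) (E : nat -> set S) :
  process_sigma X (\bigcap_(t in [set` J]) (X t @^-1` E t)).
Proof.
set G := \bigcup_t preimage_set_system [set: T] (X t) [set: set S].
have [s0 sC sU] := @smallest_sigma_algebra T setT G.
(* Closure is available for complements and countable unions; padding with [set0] outside [J] makes
   the finite intersection the complement of a union over all times. *)
pose F t := if t \in J then ~` (X t @^-1` E t) else set0.
have -> : \bigcap_(t in [set` J]) (X t @^-1` E t) = setT `\` \bigcup_t F t.
  rewrite setTD setC_bigcup; apply/seteqP; split => w wE t.
    move=> _; rewrite /F; case: ifPn => [tJ|_]; rewrite ?setCK ?setC0 //.
    exact: wE.
  by move=> /= tJ; have := wE t I; rewrite /F tJ setCK.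
apply: (sC); apply: sU => t; rewrite /F; case: ifPn => [_|_]; last exact: s0.
rewrite -setTD; apply: sC; apply: sub_sigma_algebra; exists t => //.
by exists (E t) => //; rewrite setTI.
Qed.

Lemma probability_word (d : measure_display) (T : measurableType d)
    (R : realType) (P : probability T R) (S : choiceType) (Hs : {fset S})
    (X : nat -> T -> S) (t0 : nat) (x0 : S) (L : seq S) :
  iid_uniform P Hs X -> {subset L <= Hs} ->
  P (word_event X t0 x0 L) = ((#|` Hs|%:R^-1) ^+ size L)%:E.
Proof.
move=> [_ _ PX indep] LHs; rewrite /word_event.
have /= := indep (iota t0 (size L)) (fun t => [set nth x0 L (t - t0)]).
rewrite iota_uniq => /(_ isT) ->.
rewrite big_seq (eq_bigr (fun=> (#|` Hs|%:R^-1)%:E)) => [|t]; last first.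
  rewrite mem_iota => /andP[t0t tL]; apply: PX; apply/LHs/mem_nth.
  by rewrite ltn_subLR.
rewrite -big_seq prodEFin; congr EFin.
by rewrite big_const_seq count_predT size_iota iter_mulr_1.
Qed.

(** * Law, measurability and mean of the complement delay *)

Definition no_complement (R : realType) (K : nat) (T : Type)
    (H : nat -> T -> 'M[R[i]]_K) (t0 k : nat) : set T :=
  [set w | forall j, (0 < j <= k)%N ->
     H (t0 + j)%N w <> channel_complement (H t0 w)].

(** [no_complement H t0 k] is the event that the complement delay exceeds [k]. *)
Lemma complement_delayE (R : realType) (K : nat) (T : Type)
    (H : nat -> T -> 'M[R[i]]_K) (t0 : nat) (w : T) :
  complement_delay (H ^~ w) t0 =
  (\sum_(0 <= k <oo) (\1_(no_complement H t0 k) w)%:E)%E.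
Proof.
rewrite /complement_delay delay_series; apply: eq_eseriesr => k _.
by rewrite indicE.
Qed.

(** The forbidden value depends on [H t0], so independence does not apply directly. Splitting by the
    value [M] of [H t0] fixes it, and each piece becomes a cylinder event. *)
Lemma no_complement_partition (R : realType) (K : nat)
    (Hs : {fset 'M[R[i]]_K}) (T : Type) (H : nat -> T -> 'M[R[i]]_K)
    (t0 k : nat) :
  (forall w, H t0 w \in Hs) ->
  no_complement H t0 k = \big[setU/set0]_(M <- Hs)
    \bigcap_(t in [set` iota t0 k.+1])
      (H t @^-1` (if t == t0 then [set M] else ~` [set channel_complement M])).
Proof.
move=> HHs; rewrite -bigcup_fset; apply/seteqP; split=> w.
  move=> nw; exists (H t0 w); first exact: HHs.
  move=> t tI; have := tI : t \in iota t0 k.+1.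
  rewrite mem_iota => /andP[t0t tk].
  case: (eqVneq t t0) => [->//|tt0] /=.
  have t0t' : (t0 < t)%N by rewrite ltn_neqAle eq_sym tt0.
  have := nw (t - t0)%N; rewrite subnKC //; apply.
  by rewrite subn_gt0 t0t' /= leq_subLR -ltnS -addnS.
move=> [M /= MHs wM] j /andP[j0 jk].
have tE : H t0 w = M.
  by have := wM t0; rewrite /= eqxx; apply; rewrite mem_head.
have tI : (t0 + j)%N \in iota t0 k.+1.
  by rewrite mem_iota leq_addr ltn_add2l ltnS jk.
have := wM _ tI.
by rewrite /= -[X in _ == X]addn0 eqn_add2l gtn_eqF // tE; apply.
Qed.

Lemma measurable_process_bigcap (d : measure_display) (T : measurableType d)
    (S : Type) (X : nat -> T -> S) (J : seq nat) (E : nat -> set S) :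
  (forall t, discrete_rv (X t)) ->
  measurable (\bigcap_(t in [set` J]) (X t @^-1` E t)).
Proof. by move=> mX; apply: fin_bigcap_measurable => // t _; exact: mX. Qed.

Lemma measurable_no_complement (R : realType) (K : nat)
    (Hs : {fset 'M[R[i]]_K}) (d : measure_display) (T : measurableType d)
    (P : probability T R) (H : nat -> T -> 'M[R[i]]_K) (t0 k : nat) :
  iid_uniform P Hs H -> measurable (no_complement H t0 k).
Proof.
move=> [mH HHs _ _]; rewrite (@no_complement_partition _ _ Hs)//.
apply: bigsetU_measurable => M _.
exact: (@measurable_process_bigcap _ _ _ H _
  (fun t => if t == t0 then _ else _)).
Qed.

Lemma probability_no_complement (R : realType) (K : nat)
    (Hs : {fset 'M[R[i]]_K}) (d : measure_display) (T : measurableType d)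
    (P : probability T R) (H : nat -> T -> 'M[R[i]]_K) (t0 k : nat) :
  iid_uniform P Hs H ->
  (forall M, M \in Hs -> channel_complement M \in Hs) ->
  (0 < #|` Hs|)%N ->
  P (no_complement H t0 k) = ((1 - #|` Hs|%:R^-1) ^+ k)%:E.
Proof.
move=> [mH HHs PH indep] compHs n0.
rewrite (@no_complement_partition _ _ Hs)//.
pose E (M : 'M[R[i]]_K) t :=
  if t == t0 then [set M] else ~` [set channel_complement M].
rewrite measure_fbigsetU; first last.
- apply/trivIsetP => M N _ _ MN; apply/seteqP; split=> // w [/= wM wN].
  have t0in : t0 \in iota t0 k.+1 by rewrite mem_head.
  have := wM t0 t0in; have := wN t0 t0in; rewrite /= eqxx => /= HN HM.
  by move: MN; rewrite -HM -HN eqxx.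
- by move=> M _; exact: (@measurable_process_bigcap _ _ _ H _ (E M)).
rewrite big_seq.
rewrite (eq_bigr (fun=> (#|` Hs|%:R^-1 * (1 - #|` Hs|%:R^-1) ^+ k)%:E)).
  rewrite -big_seq sumEFin big_const_seq count_predT iter_addr_0.
  by congr EFin; rewrite -[LHS]mulr_natl mulVKf// pnatr_eq0 -lt0n.
move=> M MHs; have := indep (iota t0 k.+1) (E M).
rewrite iota_uniq => /(_ isT) indepM.
rewrite [LHS]indepM [iota _ _]/= big_cons -/(iota _ _) {1}/E eqxx PH // EFinM.
congr (_ * _)%E.
(* Each later time avoids one value, which has the uniform probability because [Hs] is closed under
   complements. *)
rewrite big_seq (eq_bigr (fun=> (1 - #|` Hs|%:R^-1)%:E)) => [|t]; last first.
  rewrite mem_iota => /andP[t0t _]; rewrite /E gtn_eqF //.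
  rewrite -preimage_setC probability_setC; last exact: mH.
  by rewrite PH ?compHs.
rewrite -big_seq prodEFin; congr EFin.
by rewrite big_const_seq count_predT size_iota iter_mulr_1.
Qed.

Lemma measurable_complement_delay (R : realType) (K : nat)
    (Hs : {fset 'M[R[i]]_K}) (d : measure_display) (T : measurableType d)
    (P : probability T R) (H : nat -> T -> 'M[R[i]]_K) (t0 : nat) :
  iid_uniform P Hs H ->
  measurable_fun setT (fun w => complement_delay (H ^~ w) t0).
Proof.
move=> iidH; rewrite (funext (complement_delayE H t0)).
apply: (ge0_emeasurable_sum (P := xpredT)) => [k w _ _|k _].
  by rewrite lee_fin indicE.
apply/measurable_EFinP; apply: measurable_indic.
exact: measurable_no_complement iidH.
Qed.

(** Integrating the tail series termwise gives a geometric series of ratio [q]; its sum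
    [1 / (1 - q)] is the cardinality of [Hs]. *)
Lemma average_complement_delay (R : realType) (K : nat)
    (Hs : {fset 'M[R[i]]_K}) (d : measure_display) (T : measurableType d)
    (P : probability T R) (H : nat -> T -> 'M[R[i]]_K) (t0 : nat) :
  iid_uniform P Hs H ->
  (forall M, M \in Hs -> channel_complement M \in Hs) ->
  (0 < #|` Hs|)%N ->
  average_delay P (fun w => complement_delay (H ^~ w) t0) = (#|` Hs|%:R)%:E.
Proof.
move=> iidH compHs n0; rewrite /average_delay.
under eq_integral do rewrite complement_delayE.
have mF k := measurable_no_complement t0 k iidH.
rewrite integral_nneseries//; last first.
  by move=> k; apply/measurable_EFinP/measurable_indic.
set q : R := 1 - #|` Hs|%:R^-1.
have q0 : 0 <= q by rewrite subr_ge0 invf_le1 ?ltr0n// ler1n.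
have q1 : `|q| < 1 by rewrite ger0_norm// ltrBlDr ltrDl invr_gt0 ltr0n.
transitivity (\sum_(0 <= k <oo) (geometric 1 q k)%:E)%E.
  apply: eq_eseriesr => k _; rewrite integral_indic// setIT.
  apply: etrans (probability_no_complement t0 k iidH compHs n0) _.
  by rewrite /= mul1r.
apply/cvg_lim => //.
rewrite (_ : (fun _ => _) = EFin \o series (geometric 1 q)); last first.
  by apply/funext => N; rewrite /= sumEFin.
apply: cvg_EFin; first exact: nearW.
have -> : #|` Hs|%:R = 1 / (1 - q) by rewrite /q subKr mul1r invrK.
exact: cvg_geometric_series.
Qed.

(** * Pathwise comparison of the schemes *)

Lemma time_sharing_le_complement (R : realType) (K : nat)
    (A : 'M[R[i]]_K -> seq 'M[R[i]]_K) (c : bool) (h : nat -> 'M[R[i]]_K)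
    (t0 : nat) :
  (time_sharing_delay A c h t0 <= complement_delay h t0)%E.
Proof.
case: c => //=; apply: delay_anti => t t0t ht; left.
by exists t => //; rewrite t0t leqnn.
Qed.

(** The word [L] shows the other three members by time [t0 + 3], and it cannot contain the
    complement, which lies outside the alignment set. The gain is additive so that it can be
    integrated as an indicator. *)
Lemma first_to_complete_faster (R : realType) (K : nat)
    (A : 'M[R[i]]_K -> seq 'M[R[i]]_K) (h : nat -> 'M[R[i]]_K) (t0 : nat)
    (L := h t0 :: rem (h t0) (A (h t0))) :
  size (A (h t0)) = 4%N -> h t0 \in A (h t0) ->
  channel_complement (h t0) \notin A (h t0) ->
  (forall j, (j < 4)%N -> h (t0 + j)%N = nth 0 L j) ->
  (first_to_complete_delay A h t0 + 1 <= complement_delay h t0)%E.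
Proof.
move=> sA hA compA hL.
have sr : size (rem (h t0) (A (h t0))) = 3%N by rewrite size_rem // sA.
apply: (@le_trans _ _ (4%:R)%:E).
  rewrite (_ : 4%:R = 3%:R + 1) ?EFinD; last by rewrite -natr1.
  apply: leeD => //.
  apply: (@le_trans _ _ ((t0 + 3 - t0)%N%:R)%:E); last by rewrite addKn.
  apply: delay_le; first by rewrite -[X in (X < _)%N]addn0 ltn_add2l.
  right => M MA Mh; have Mr := rem_mem Mh MA.
  have ltr : (index M (rem (h t0) (A (h t0))) < 3)%N by rewrite -sr index_mem.
  (* The successor accounts for the head of [L], which is read at time [t0] itself. *)
  exists (t0 + (index M (rem (h t0) (A (h t0)))).+1)%N.
    by rewrite leq_add2l ltr -[X in (X < _)%N]addn0 ltn_add2l.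
  by rewrite hL //= nth_index.
apply: delay_ge => t t0t ht; rewrite leqNgt; apply/negP => lt4.
have tL : channel_complement (h t0) = nth 0 L (t - t0).
  by rewrite -ht -hL // subnKC // ltnW.
move: compA; rewrite tL => /negP; apply.
have := t0t; rewrite -subn_gt0; case: (t - t0)%N lt4 => // j j3 _ /=.
by apply: (mem_rem (x := h t0)); rewrite mem_nth ?sr.
Qed.

(** * From the pathwise gain to the averages *)

Theorem corollary7 (R : realType) (K : nat) (Hs : {fset 'M[R[i]]_K})
  (A : 'M[R[i]]_K -> seq 'M[R[i]]_K)
  (hA : forall M, M \in Hs -> alignment4_for Hs M (A M))
  (d : measure_display) (T : measurableType d) (P : probability T R)
  (H : nat -> T -> 'M[R[i]]_K) (hH : iid_uniform P Hs H)
  (alpha : R) (halpha : 0 <= alpha <= 1)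
  (C : T -> bool) (hC : independent_coin P alpha H C) (t0 : nat) :
  let D_sharing :=
    average_delay P (fun w => time_sharing_delay A (C w) (H ^~ w) t0) in
  let D_complement :=
    average_delay P (fun w => complement_delay (H ^~ w) t0) in
  (D_sharing <= D_complement)%E /\
  (0 < alpha -> (D_sharing < D_complement)%E).
Proof.
move=> Dsh Dc.
have [mH HHs PH indepH] := hH; have [mC PC indepC] := hC.
have Dge0 w : (0 <= time_sharing_delay A (C w) (H ^~ w) t0)%E.
  by case: (C w); exact: delay_ge0.
have Dle w := time_sharing_le_complement A (C w) (H ^~ w) t0.
split; first exact: ge0_le_integralT_nomeas.
move=> alpha0.
(* Sampling the process at the default point of [T] yields an element of [Hs], which is thus
   nonempty. *)
pose M := H t0 point; have MHs : M \in Hs by exact: HHs.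
have [[_ _ sA _ _] MA _ AHs [_ compA]] := hA _ MHs.
have n0 : (0 < #|` Hs|)%N by rewrite cardfs_gt0; apply/fset0Pn; exists M.
pose L := M :: rem M (A M).
have sL : size L = 4%N by rewrite /= size_rem // sA.
have LHs : {subset L <= Hs}.
  by move=> N; rewrite -(perm_mem (perm_to_rem MA)); exact: AHs.
pose E := C @^-1` [set true] `&` word_event H t0 0 L.
have mE : measurable E.
  by apply: measurableI; [exact: mC|exact: measurable_process_bigcap].
have PE : (0 < P E)%E.
  rewrite indepC; last exact: process_sigma_bigcap.
  rewrite PC (probability_word _ _ hH)// -EFinM lte_fin mulr_gt0//.
  by rewrite exprn_gt0// invr_gt0 ltr0n.
(* The indicator is subtracted from the complement delay, the side known to be measurable, so that
   additivity of the integral is used only there. *)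
have faster w : (time_sharing_delay A (C w) (H ^~ w) t0 <=
    complement_delay (H ^~ w) t0 - (\1_E w)%:E)%E.
  rewrite leeBrDr// indicE.
  have [wE|_] := boolP (w \in E); last by rewrite adde0.
  move: wE; rewrite inE => -[/= -> wL].
  have hL j : (j < 4)%N -> H (t0 + j)%N w = nth 0 L j.
    rewrite -sL => jL; have tL : (t0 + j)%N \in iota t0 (size L).
      by rewrite mem_iota leq_addr ltn_add2l.
    by have := wL _ tL; rewrite /= addKn.
  have HM : H t0 w = M by rewrite -[t0]addn0 hL.
  by apply: first_to_complete_faster; rewrite HM.
have mDc := measurable_complement_delay t0 hH.
have m1 : measurable_fun setT (fun w => (\1_E w)%:E : \bar R).
  by apply/measurable_EFinP/measurable_indic.
have DcE : Dc =
    (\int[P]_w (complement_delay (H ^~ w) t0 - (\1_E w)%:E) + P E)%E.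
  rewrite -[E in P E]setIT -integral_indic// -ge0_integralD//.
  - by apply: eq_integral => w _; rewrite subeK.
  - by move=> w _; exact: le_trans (faster w).
  - exact: emeasurable_funB.
have Dc_fin : Dc \is a fin_num.
  rewrite /Dc (average_complement_delay _ hH)// => N /hA.
  by case=> _ _ _ _ [].
have le1 := ge0_le_integralT_nomeas P Dge0 faster.
apply: (le_lt_trans le1).
(* Finiteness of [Dc] passes to the integral of the difference, so adding [P E > 0] strictly
   increases it. *)
move: Dc_fin; rewrite DcE fin_numD => /andP[If _].
by rewrite lteDl.
Qed.
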